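(* Let $n\ge 2$, let $\mathscr{C}_H\subseteq\mathbb{F}_2^{2^n-1}$ be the $[2^n-1,\,2^n-1-n,\,3]$ Hamming code and let $\mathbf{w}_1,\ldots,\mathbf{w}_{|\mathcal{C}_o|}$ be the elements of $\mathcal{C}_o$, the set of odd-weight codewords, where $|\mathcal{C}_o|=2^{2^n-n-2}$. Let $G_4'=(\mathcal{C}_o,\mathcal{E}_4')$ be the graph with $\{\mathbf{w}_i,\mathbf{w}_j\}\in\mathcal{E}_4'$ iff $d_H(\mathbf{w}_i,\mathbf{w}_j)=4$, and let $A'$ be its adjacency matrix. Let $\mathbf{p}'\in\mathbb{F}_2^2$ with bitwise complement $\overline{\mathbf{p}'}$, so that $\{\mathbf{p}',\overline{\mathbf{p}'}\}$ is one of $P_e=\{00,11\}$ and $P_o=\{01,10\}$. For a parity assignment $\pi:\mathcal{C}_o\to\{\mathbf{p}',\overline{\mathbf{p}'}\}$ define the cut vector $\mathbf{z}\in\{+1,-1\}^{|\mathcal{C}_o|}$ by $z_i=+1$ if $\pi(\mathbf{w}_i)=\mathbf{p}'$ and $z_i=-1$ if $\pi(\mathbf{w}_i)=\overline{\mathbf{p}'}$. Then the number of same-parity pairs in $\mathcal{E}_4'$, i.e. of edges $\{\mathbf{w}_i,\mathbf{w}_j\}\in\mathcal{E}_4'$ with $\pi(\mathbf{w}_i)=\pi(\mathbf{w}_j)$, is minimized (over all assignments $\pi:\mathcal{C}_o\to\{\mathbf{p}',\overline{\mathbf{p}'}\}$) if and only if $\mathbf{z}$ minimizes $\mathbf{z}^\top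 A'\mathbf{z}$ (over $\{+1,-1\}^{|\mathcal{C}_o|}$).
   Context: The $[2^n-1,\,2^n-1-n,\,3]$ Hamming code is the kernel over $\mathbb{F}_2$ of an $n\times(2^n-1)$ matrix whose columns are all the nonzero vectors of $\mathbb{F}_2^n$, each appearing once. $d_H$ is Hamming distance. The rows and columns of $A'$ are indexed according to the ordering $\mathbf{w}_1,\ldots,\mathbf{w}_{|\mathcal{C}_o|}$. *)

(* Defs.v *)
From mathcomp Require Import all_boot all_order all_algebra.

Set Implicit Arguments.
Unset Strict Implicit.
Unset Printing Implicit Defensive.

Import Order.TTheory GRing.Theory Num.Theory.
Local Open Scope ring_scope.

Definition hamming_wt (m : nat) (c : 'rV['F_2]_m) : nat :=
  #|[set k | c 0 k != 0]|.

Definition hamming_dist (m : nat) (c d : 'rV['F_2]_m) : nat :=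
  #|[set k | c 0 k != d 0 k]|.

(* The columns of H are exactly the nonzero vectors, without repetition; this
   forces m = 2 ^ n - 1. *)
Definition hamming_check_matrix (n m : nat) (H : 'M['F_2]_(n, m)) : Prop :=
  (forall k, col k H != 0) /\
  (forall v : 'cV['F_2]_n, v != 0 -> exists! k, col k H = v).

Definition code_of (n m : nat) (H : 'M['F_2]_(n, m)) : {set 'rV['F_2]_m} :=
  [set c | H *m c^T == 0].

Definition odd_codewords (n m : nat) (H : 'M['F_2]_(n, m)) :
    {set 'rV['F_2]_m} :=
  [set c in code_of H | odd (hamming_wt c)].

(* The odd-weight codewords as a type: it is the vertex set of the graph and
   the domain of the parity assignments. *)
Definition odd_codeword (n m : nat) (H : 'M['F_2]_(n, m)) : finType :=
  {c : 'rV['F_2]_m | c \in odd_codewords H}.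

(* Edges are unordered pairs; distance 4 makes the endpoints distinct. *)
Definition edges4 (n m : nat) (H : 'M['F_2]_(n, m)) :
    {set {set odd_codeword H}} :=
  [set e | [exists u, exists v,
     (e == [set u; v]) && (hamming_dist (val u) (val v) == 4)]].

Definition adjacency4 (n m : nat) (H : 'M['F_2]_(n, m)) (N : nat)
    (w : 'I_N -> odd_codeword H) : 'M[int]_N :=
  \matrix_(i, j) ([set w i; w j] \in edges4 H)%:R.

Definition bit_compl (p : 'rV['F_2]_2) : 'rV['F_2]_2 :=
  \row_k (1 + p 0 k).

Definition bits2 (a b : 'F_2) : 'rV['F_2]_2 :=
  \row_k (if k == 0 then a else b).

Definition even_parities : {set 'rV['F_2]_2} := [set bits2 0 0; bits2 1 1].
Definition odd_parities : {set 'rV['F_2]_2} := [set bits2 0 1; bits2 1 0].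

Definition parity_pair (p : 'rV['F_2]_2) : {set 'rV['F_2]_2} :=
  [set p; bit_compl p].

Definition parity_assignment (n m : nat) (H : 'M['F_2]_(n, m))
    (p : 'rV['F_2]_2) : Type :=
  odd_codeword H -> {q : 'rV['F_2]_2 | q \in parity_pair p}.

Definition same_parity_edges (n m : nat) (H : 'M['F_2]_(n, m))
    (p : 'rV['F_2]_2) (pi : parity_assignment H p) :
    {set {set odd_codeword H}} :=
  [set e in edges4 H | [exists u, exists v,
     (e == [set u; v]) && (pi u == pi v)]].

Definition cut_vector (n m : nat) (H : 'M['F_2]_(n, m)) (p : 'rV['F_2]_2)
    (N : nat) (w : 'I_N -> odd_codeword H) (pi : parity_assignment H p) :
    'cV[int]_N :=
  \col_i (if val (pi (w i)) == p then 1 else -1).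

Definition sign_vector (N : nat) (z : 'cV[int]_N) : Prop :=
  forall i, z i 0 = 1 \/ z i 0 = -1.

Definition quad_form (N : nat) (A : 'M[int]_N) (z : 'cV[int]_N) : int :=
  (z^T *m A *m z) 0 0.

(* Main.v *)
(** The odd codewords form one fibre of the additive map sending [c] to its
    syndrome and its coordinate sum.  This map is onto: a column [v] of [H]
    gives the value [(v, 1)], and combining three columns [a], [b], [a + b]
    gives [(0, 1)].  For the graph, every edge contributes twice to [z^T A' z],
    with sign [+1] or [-1] according to whether its ends have the same parity,
    so [z^T A' z = 4 s - 2 |E4'|] where [s] is the number of same-parity edges;
    moreover every sign vector is a cut vector. *)
Require Import Defs.
From HB Require Import structures.
From mathcomp Require Import all_boot all_order all_algebra.
From mathcomp Require Import zify.

Set Implicit Arguments.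
Unset Strict Implicit.
Unset Printing Implicit Defensive.

Import Order.TTheory GRing.Theory Num.Theory.
Local Open Scope ring_scope.

(** Joins finiteness and addition on a product, so that ['cV['F_2]_n * 'F_2] can serve as the
    codomain in [card_fiber_additive]. *)
HB.instance Definition _ (U V : finZmodType) := Finite.on (U * V)%type.

(** Translation by a preimage of [y' - y] carries the fibre over [y] onto the fibre over [y'], so
    all [#|W|] fibres have the same size. *)
Lemma card_fiber_additive (V W : finZmodType) (f : {additive V -> W}) (y : W) :
  (forall y', exists x, f x = y') ->
  #|V| = (#|W| * #|[set x | f x == y]|)%N.
Proof.
move=> f_surj.
have fiberE y' : #|[set x | f x == y']| = #|[set x | f x == y]|.
  have [x0 fx0] := f_surj (y' - y).
  rewrite -[RHS](card_imset _ (@addrI _ x0)); apply: eq_card => x.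
  rewrite !inE; apply/idP/imsetP => [/eqP fx|[x1]].
    by exists (x - x0); rewrite ?inE ?raddfB ?fx ?fx0 ?subKr // addrC subrK.
  by rewrite inE => /eqP fx1 ->; rewrite raddfD fx0 fx1 subrK.
rewrite -[LHS]sum1_card (partition_big f predT) //= -sum_nat_const.
apply: eq_big => // y' _; rewrite -(fiberE y') -sum1_card.
by apply: eq_bigl => x; rewrite inE.
Qed.

(** * Syndromes, weight parity and the number of odd codewords *)

Lemma F2_cases (x : 'F_2) : x = 0 \/ x = 1.
Proof. by case: x => [[|[|//]] lt_x2]; [left | right]; apply: val_inj. Qed.

Lemma oddE_F2 (k : nat) : odd k = (k%:R == 1 :> 'F_2).
Proof.
elim: k => //= k ->; rewrite -natr1.
by case: (F2_cases k%:R) => ->.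
Qed.

Lemma hamming_wt_F2 m (c : 'rV['F_2]_m) :
  (hamming_wt c)%:R = \sum_k c 0 k :> 'F_2.
Proof.
rewrite /hamming_wt -sum1_card natr_sum big_mkcond /=.
by apply: eq_bigr => k _; rewrite inE; case: (F2_cases (c 0 k)) => ->.
Qed.

Definition syndrome_parity n m (H : 'M['F_2]_(n, m)) (c : 'rV['F_2]_m) :
    'cV['F_2]_n * 'F_2 :=
  (H *m c^T, \sum_k c 0 k).

Lemma syndrome_parity_is_additive n m (H : 'M['F_2]_(n, m)) :
  zmod_morphism (syndrome_parity H).
Proof.
move=> c d; rewrite /syndrome_parity linearB mulmxBr /=.
congr pair; rewrite /= -sumrB; by apply: eq_bigr => k _; rewrite !mxE.
Qed.

HB.instance Definition _ n m (H : 'M['F_2]_(n, m)) :=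
  GRing.isZmodMorphism.Build _ _ _ (syndrome_parity_is_additive H).

Lemma odd_codewordsE n m (H : 'M['F_2]_(n, m)) :
  odd_codewords H = [set c | syndrome_parity H c == (0, 1)].
Proof. by apply/setP => c; rewrite !inE oddE_F2 hamming_wt_F2. Qed.

Lemma syndrome_parity_delta n m (H : 'M['F_2]_(n, m)) k :
  syndrome_parity H (delta_mx 0 k) = (col k H, 1).
Proof.
rewrite /syndrome_parity trmx_delta -colE (bigD1 k) //= big1 ?addr0.
  by rewrite mxE !eqxx.
by move=> j /negPf jk; rewrite mxE jk andbF.
Qed.

Lemma syndrome_parity_surj n m (H : 'M['F_2]_(n, m)) :
  (1 < n)%N -> hamming_check_matrix H ->
  forall y, exists c, syndrome_parity H c = y.
Proof.
case: n H => [|[|n]] // H _ [_ colH].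
have nz_pre v : v != 0 -> exists c, syndrome_parity H c = (v, 1).
  move=> /colH[k [<- _]]; exists (delta_mx 0 k).
  exact: syndrome_parity_delta.
(* Two distinct coordinates exist because [n] is at least 2; they make [a], [b] and [a + b] all
   nonzero, hence columns of [H]. *)
pose i0 : 'I_n.+2 := ord0; pose i1 : 'I_n.+2 := lift ord0 ord0.
pose a : 'cV['F_2]_n.+2 := delta_mx i0 0.
pose b : 'cV['F_2]_n.+2 := delta_mx i1 0.
have nz (v : 'cV['F_2]_n.+2) i : v i 0 = 1 -> v != 0.
  by move=> vi; apply/eqP => v0; move: vi; rewrite v0 mxE.
have [ca fa] : exists c, syndrome_parity H c = (a, 1).
  by apply: nz_pre; apply: (nz _ i0); rewrite mxE.
have [cb fb] : exists c, syndrome_parity H c = (b, 1).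
  by apply: nz_pre; apply: (nz _ i1); rewrite mxE.
have [cab fab] : exists c, syndrome_parity H c = (a + b, 1).
  by apply: nz_pre; apply: (nz _ i0); rewrite !mxE eqxx /= addr0.
have f01 : syndrome_parity H (cab - ca - cb) = (0, 1).
  rewrite !syndrome_parity_is_additive fa fb fab; congr pair.
    by rewrite /= addrAC addrK subrr.
  exact: val_inj.
case=> v x.
have [->|nz_v] := eqVneq v 0.
  case: (F2_cases x) => ->; first by exists 0; rewrite raddf0.
  by eexists; exact: f01.
have [c fc] := nz_pre v nz_v.
case: (F2_cases x) => ->; last by exists c.
(* Subtracting the preimage of [(0, 1)] turns [(v, 1)] into [(v, 0)]. *)
exists (c - (cab - ca - cb)); rewrite syndrome_parity_is_additive fc f01.
by congr pair; rewrite /= ?subr0 ?subrr.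
Qed.

Lemma card_odd_codewords n (H : 'M['F_2]_(n, (2 ^ n - 1)%N)) :
  (1 < n)%N -> hamming_check_matrix H ->
  #|odd_codewords H| = (2 ^ (2 ^ n - n - 2))%N.
Proof.
move=> n_gt1 hH.
have := @card_fiber_additive _ ('cV['F_2]_n * 'F_2)%type _ (0, 1)
  (syndrome_parity_surj n_gt1 hH).
rewrite -odd_codewordsE card_prod !card_mx card_Fp // mul1n muln1 -expnSr.
(* Ensures that the subtraction in the exponent [2 ^ n - n - 2] is not truncated. *)
have le_n2 : (n + 2 <= 2 ^ n)%N.
  elim: n n_gt1 {H hH} => [|[|[|n]] IHn] // _.
  by rewrite expnS; have := IHn isT; lia.
(* The summand [n.+1] is the dimension of the space of pairs (syndrome, parity), whose cardinality
   is then cancelled. *)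
have mE : (2 ^ n - 1 = n.+1 + (2 ^ n - n - 2))%N by lia.
by rewrite [in LHS]mE expnD => /eqP; rewrite eqn_pmul2l ?expn_gt0 // => /eqP ->.
Qed.

(** * Unordered edges versus ordered pairs *)

Lemma set2_eq_cases (T : finType) (u v x y : T) :
  [set u; v] = [set x; y] -> (u = x /\ v = y) \/ (u = y /\ v = x).
Proof.
move=> e.
have: u \in [set x; y] by rewrite -e !inE eqxx.
have: v \in [set x; y] by rewrite -e !inE eqxx orbT.
have: x \in [set u; v] by rewrite e !inE eqxx.
have: y \in [set u; v] by rewrite e !inE eqxx orbT.
by rewrite !inE => /orP[]/eqP ? /orP[]/eqP ? /orP[]/eqP ? /orP[]/eqP ?;
  subst; auto.
Qed.

(** The map [(u, v) |-> {u, v}] is two-to-one onto the edges: irreflexivity makes [(u, v)] and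
    [(v, u)] distinct, and symmetry puts both in the relation. *)
Lemma card_sym_pairs (T : finType) (r : rel T) :
  symmetric r -> irreflexive r ->
  #|[set x : T * T | r x.1 x.2]| =
  (2 * #|[set e : {set T} | [exists u, exists v,
                              (e == [set u; v]) && r u v]]|)%N.
Proof.
move=> r_sym r_irr; set E := [set e : {set T} | _].
rewrite -[LHS]sum1_card.
rewrite (partition_big (fun x : T * T => [set x.1; x.2]) [in E]) /=; last first.
  case=> u v; rewrite !inE /= => ruv.
  by apply/existsP; exists u; apply/existsP; exists v; rewrite eqxx.
rewrite mulnC -sum_nat_const; apply: eq_bigr => e.
rewrite inE => /existsP[u /existsP[v /andP[/eqP-> ruv]]].
have u'v : u != v by apply/eqP => uv; rewrite uv r_irr in ruv.
rewrite sum1dep_card (_ : [set _ | _] = [set (u, v); (v, u)]).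
  by rewrite cards2 xpair_eqE (negPf u'v).
apply/setP => -[x y]; rewrite !inE !xpair_eqE /=.
apply/andP/orP => [[rxy /eqP exy]|].
  by case: (set2_eq_cases exy) => -[-> ->]; rewrite !eqxx; [left | right].
case=> /andP[/eqP-> /eqP->]; first by rewrite eqxx.
by rewrite r_sym setUC eqxx.
Qed.

(** * The quadratic form of a cut *)

Section Cut.

Variables (n m : nat) (H : 'M['F_2]_(n, m)).

Definition adj4 : rel (odd_codeword H) :=
  fun u v => hamming_dist (val u) (val v) == 4.

Lemma adj4_sym : symmetric adj4.
Proof.
move=> u v; rewrite /adj4 /hamming_dist; congr (_ == _).
by apply: eq_card => k; rewrite !inE eq_sym.
Qed.

Lemma adj4_irr : irreflexive adj4.
Proof.
move=> u; rewrite /adj4 /hamming_dist (_ : [set _ | _] = set0) ?cards0 //.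
by apply/setP => k; rewrite !inE eqxx.
Qed.

Lemma mem_edges4 u v : ([set u; v] \in edges4 H) = adj4 u v.
Proof.
rewrite inE; apply/existsP/idP => [[x /existsP[y /andP[/eqP e xy]]]|uv].
  by case: (set2_eq_cases e) => -[-> ->] //; rewrite adj4_sym.
by exists u; apply/existsP; exists v; rewrite eqxx.
Qed.

Variable p : 'rV['F_2]_2.
Implicit Type pi : parity_assignment H p.

Lemma same_parity_edgesE pi :
  same_parity_edges pi = [set e | [exists u, exists v,
     (e == [set u; v]) && (adj4 u v && (pi u == pi v))]].
Proof.
apply/setP => e; rewrite [LHS]inE [RHS]inE.
apply/andP/existsP => [[eE /existsP[u /existsP[v /andP[/eqP de uv]]]]|].
  exists u; apply/existsP; exists v.
  by rewrite de eqxx uv andbT -mem_edges4 -de.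
case=> u /existsP[v /andP[/eqP-> /andP[uv piuv]]]; rewrite mem_edges4.
by split=> //; apply/existsP; exists u; apply/existsP; exists v; rewrite eqxx.
Qed.

Variables (N : nat) (w : 'I_N -> odd_codeword H).

(** Only two parities are available, so two values that both differ from [p] coincide; the sign
    product is therefore 1 on equal parities and -1 otherwise. *)
Lemma cut_vectorM pi i j :
  cut_vector w pi i 0 * cut_vector w pi j 0 =
  ((pi (w i) == pi (w j))%:R *+ 2 - 1 : int).
Proof.
have -> : (pi (w i) == pi (w j)) = (val (pi (w i)) == val (pi (w j))) by [].
rewrite !mxE; move: (valP (pi (w i))) (valP (pi (w j))).
move: (val (pi (w i))) (val (pi (w j))) => a b; rewrite !inE.
have [->|/negPf ne_ap] := eqVneq a p; have [->|_] := eqVneq b p => //=.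
  by rewrite ne_ap.
by move=> /eqP-> /eqP->; rewrite eqxx.
Qed.

Lemma cut_vector_sign pi : sign_vector (cut_vector w pi).
Proof. by move=> i; rewrite mxE; case: ifP; [left | right]. Qed.

(** The subtracted count of ordered pairs is twice the number of edges and does not depend on [pi],
    so only the same-parity count varies. *)
Lemma quad_form_cut pi : bijective w ->
  quad_form (adjacency4 w) (cut_vector w pi) =
  (4 * #|same_parity_edges pi|)%:Z
    - #|[set x : odd_codeword H * odd_codeword H | adj4 x.1 x.2]|%:Z.
Proof.
move=> w_bij.
have same_sym : symmetric (fun u v => adj4 u v && (pi u == pi v)).
  by move=> u v; rewrite adj4_sym eq_sym.
have same_irr : irreflexive (fun u v => adj4 u v && (pi u == pi v)).
  by move=> u; rewrite adj4_irr.
(* One factor 2 is absorbed by passing to ordered pairs; the other comes from [cut_vectorM]. *)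
rewrite -[4%N]/(2 * 2)%N -mulnA same_parity_edgesE -card_sym_pairs //.
(* The bijection [w] replaces indices by codewords, and an adjacency entry times the sign product
   expands into this summand. *)
transitivity (\sum_u \sum_v
    ((adj4 u v && (pi u == pi v))%:R *+ 2 - (adj4 u v)%:R : int)).
  rewrite /quad_form mxE.
  rewrite [RHS](reindex w) /=; last exact: onW_bij.
  under eq_bigr => j _ do rewrite mxE big_distrl /=.
  rewrite exchange_big /=; apply: eq_bigr => i _.
  rewrite [RHS](reindex w) /=; last exact: onW_bij.
  apply: eq_bigr => j _.
  rewrite ![(_^T) _ _]mxE [adjacency4 _ _ _]mxE mem_edges4 mulrAC cut_vectorM.
  by case: (adj4 _ _); rewrite ?mulr1 ?mulr0.
rewrite pair_big /= sumrB sumrMnl mul2n -addnn PoszD mulr2n.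
have cardE (r : rel (odd_codeword H)) :
    \sum_x (r x.1 x.2)%:R = #|[set x | r x.1 x.2]|%:Z.
  rewrite -natz -sum1_card natr_sum [RHS]big_mkcond /=.
  by apply: eq_bigr => x _; rewrite inE; case: (r _ _).
by rewrite (cardE adj4) (cardE (fun u v => adj4 u v && (pi u == pi v))).
Qed.

Lemma bit_compl_neq : bit_compl p != p.
Proof.
apply/eqP => /rowP/(_ 0); rewrite mxE.
by case: (F2_cases (p 0 0)) => ->.
Qed.

(** Reading the signs back through the inverse of [w] gives the assignment; [bit_compl p != p] keeps
    the sign -1 distinguishable. *)
Lemma cut_vector_surj (z : 'cV[int]_N) : bijective w -> sign_vector z ->
  exists pi, cut_vector w pi = z.
Proof.
case=> w' wK w'K z_sign.
have p_in : p \in parity_pair p by rewrite !inE eqxx.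
have q_in : bit_compl p \in parity_pair p by rewrite !inE eqxx orbT.
exists (fun u => if z (w' u) 0 == 1 then exist _ p p_in
                 else exist _ (bit_compl p) q_in).
apply/colP => i; rewrite mxE wK.
by case: (z_sign i) => ->; rewrite /= ?eqxx // (negPf bit_compl_neq).
Qed.

End Cut.

(** Flipping both bits preserves their sum, which selects one of the two classes. *)
Lemma parity_pair_cases p :
  parity_pair p = even_parities \/ parity_pair p = odd_parities.
Proof.
have pE : p = bits2 (p 0 0) (p 0 1).
  by apply/rowP => k; rewrite mxE; case: k => [[|[|//]] ltk] /=;
     congr (p 0 _); apply: val_inj.
have complE a b : bit_compl (bits2 a b) = bits2 (1 + a) (1 + b).
  by apply/rowP => k; rewrite !mxE; case: ifP.
have F2_11 : 1 + 1 = 0 :> 'F_2 by apply: val_inj.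
rewrite /parity_pair /even_parities /odd_parities pE complE.
case: (F2_cases (p 0 0)) => ->; case: (F2_cases (p 0 1)) => ->;
  rewrite ?F2_11 ?addr0; [left | right | right | left] => //; exact: setUC.
Qed.

Theorem theorem6 (n : nat) (n_ge2 : (2 <= n)%N)
    (H : 'M['F_2]_(n, (2 ^ n - 1)%N)) (hH : hamming_check_matrix H) :
  #|odd_codewords H| = (2 ^ (2 ^ n - n - 2))%N /\
  forall (w : 'I_(#|odd_codewords H|) -> odd_codeword H) (hw : bijective w)
         (p : 'rV['F_2]_2),
    (parity_pair p = even_parities \/ parity_pair p = odd_parities) /\
    forall pi : parity_assignment H p,
      (forall pi' : parity_assignment H p,
         (#|same_parity_edges pi| <= #|same_parity_edges pi'|)%N)
      <->
      (sign_vector (cut_vector w pi) /\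
       forall z : 'cV[int]_#|odd_codewords H|, sign_vector z ->
         quad_form (adjacency4 w) (cut_vector w pi)
           <= quad_form (adjacency4 w) z).
Proof.
split; first exact: card_odd_codewords.
move=> w w_bij p; split; first exact: parity_pair_cases.
move=> pi.
(* The constant term cancels and the factor 4 is positive, so both objectives order the assignments
   identically. *)
have quad_le pi' : (quad_form (adjacency4 w) (cut_vector w pi)
    <= quad_form (adjacency4 w) (cut_vector w pi')) =
    (#|same_parity_edges pi| <= #|same_parity_edges pi'|)%N.
  by rewrite !quad_form_cut // lerD2r lez_nat leq_pmul2l.
split=> [min_pi|[_ min_pi] pi'].
  split=> [|z]; first exact: cut_vector_sign.
  by move=> /(cut_vector_surj p w_bij)[pi' <-]; rewrite quad_le.
by rewrite -quad_le; apply: min_pi; apply: cut_vector_sign.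
Qed.
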